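(* Let $K=\mathbb{C}_p$. For any ball system $(\mathcal{B},\tau,\mathcal{B}')$ in $K$ with $U=\bigcup_i B_i$, there exists a rational function $\phi\in K(z)$ that interprets $\tau$ with inclusion (i.e. $\phi(B_i)\subseteq B'_{\tau(i)}$ for all $i$) and has no poles in $U$. Moreover, $\phi$ can be chosen analytic on $U$, i.e. with all poles in $\mathbb{P}^1(K)\setminus U$.
   Context: For $a\in K$, $r>0$, $B(a,r)=\{z\in K:|z-a|\le r\}$ is the closed ball. A ball system is a triple $(\mathcal{B},\tau,\mathcal{B}')$ where $\mathcal{B}=\{B_i=B(a_i,r_i)\}_{i=1}^N$ is a finite collection of pairwise disjoint closed balls, $\tau:\{1,\dots,N\}\to\{1,\dots,N\}$ is a map, and $\mathcal{B}'=\{B_i'=B(b_i,t_i)\}_{i=1}^N$ is a family of closed balls. A map $\phi$, analytic in a neighborhood of $U$ (for rational $\phi$: with no poles on some open neighborhood of $U$), interprets $\tau$ with inclusion if $\phi(B_i)\subseteq B'_{\tau(i)}$ for all $i$. *)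

(* Defs.v *)
From mathcomp Require Import all_boot all_order all_algebra.
From mathcomp Require Import all_classical all_reals.
From mathcomp Require Import topology normedtype.

Set Implicit Arguments.
Unset Strict Implicit.
Unset Printing Implicit Defensive.

Import Order.TTheory GRing.Theory Num.Theory.
Local Open Scope classical_set_scope.
Local Open Scope ring_scope.

(** * The valued field [C_p] *)

Definition padic_abs (R : realType) (p : nat) (x : rat) : R :=
  if x == 0 then 0
  else (p%:R : R) ^ ((logn p `|denq x|%N)%:Z - (logn p `|numq x|%N)%:Z).

Record nonarch_abs (R : realType) (K : fieldType) (abs : K -> R) : Prop :=
  NonarchAbs {
    nabs_ge0 : forall x, 0 <= abs x ;
    nabs_eq0 : forall x, abs x = 0 <-> x = 0 ;
    nabsM : forall x y, abs (x * y) = abs x * abs y ;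
    nabsD : forall x y, abs (x + y) <= Num.max (abs x) (abs y)
  }.

Definition abs_cauchy (R : realType) (K : fieldType) (abs : K -> R)
    (u : nat -> K) : Prop :=
  forall e : R, 0 < e -> exists N : nat,
    forall m n : nat, (N <= m)%N -> (N <= n)%N -> abs (u m - u n) < e.

Definition abs_cvg_to (R : realType) (K : fieldType) (abs : K -> R)
    (u : nat -> K) (l : K) : Prop :=
  forall e : R, 0 < e -> exists N : nat,
    forall n : nat, (N <= n)%N -> abs (u n - l) < e.

Record is_completion (R : realType) (F K : fieldType)
    (absF : F -> R) (absK : K -> R) (iota : {rmorphism F -> K}) : Prop :=
  IsCompletion {
    completion_abs : nonarch_abs absK ;
    completion_isometry : forall x, absK (iota x) = absF x ;
    completion_dense : forall (y : K) (e : R), 0 < e ->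
      exists x : F, absK (y - iota x) < e ;
    completion_complete : forall u : nat -> K,
      abs_cauchy absK u -> exists l : K, abs_cvg_to absK u l
  }.

Definition is_algebraic_closure (F : fieldType) (L : closedFieldType)
    (iota : {rmorphism F -> L}) : Prop :=
  forall y : L, algebraicOver iota y.

(* [(K, abs)] is [C_p] when [K] is the completion of an algebraic closure of
   [Q_p], [Q_p] being the completion of [Q] for the [p]-adic absolute value;
   each step of the tower is unique up to isometric isomorphism. *)
Definition is_Cp (R : realType) (p : nat) (K : fieldType) (abs : K -> R) :
    Prop :=
  exists (Qp : fieldType) (absQp : Qp -> R) (i : {rmorphism rat -> Qp})
         (Qpbar : closedFieldType) (absbar : Qpbar -> R)
         (j : {rmorphism Qp -> Qpbar}) (k : {rmorphism Qpbar -> K}),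
    [/\ is_completion (@padic_abs R p) absQp i,
        is_algebraic_closure j,
        nonarch_abs absbar,
        forall x, absbar (j x) = absQp x
      & is_completion absbar abs k].

(** * Rational functions

    Elements of [K(z)] are evaluated, and their poles defined, through a
    representation in lowest terms. *)

Section RationalFunctions.
Variable K : fieldType.
Implicit Type phi : {fraction {poly K}}.

Definition rf_gcd phi : {poly K} := gcdp (frac (repr phi)).1 (frac (repr phi)).2.
Definition rf_num phi : {poly K} := (frac (repr phi)).1 %/ rf_gcd phi.
Definition rf_den phi : {poly K} := (frac (repr phi)).2 %/ rf_gcd phi.

(* The value is meaningful only outside the poles. *)
Definition rf_eval phi (z : K) : K := (rf_num phi).[z] / (rf_den phi).[z].

(* Points of P^1(K) are [Some z], for [z] in [K], and [None], the point at
   infinity. *)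
Definition rf_pole phi (x : option K) : Prop :=
  match x with
  | Some z => root (rf_den phi) z
  | None => (size (rf_den phi) < size (rf_num phi))%N
  end.

End RationalFunctions.

(** * Ball systems *)

Section BallSystems.
Variables (R : realType) (K : fieldType) (abs : K -> R).

Record ball_system (N : nat) := BallSystem {
  center : 'I_N -> K ;
  radius : 'I_N -> R ;
  radius_gt0 : forall i, 0 < radius i ;
  balls_disjoint :
    trivIset setT (fun i => closed_ball_ abs (center i) (radius i)) ;
  bs_map : 'I_N -> 'I_N ;
  target_center : 'I_N -> K ;
  target_radius : 'I_N -> R ;
  target_radius_gt0 : forall i, 0 < target_radius i
}.

Variables (N : nat) (S : ball_system N).

Definition source_ball (i : 'I_N) : set K :=
  closed_ball_ abs (center S i) (radius S i).

Definition target_ball (i : 'I_N) : set K :=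
  closed_ball_ abs (target_center S i) (target_radius S i).

Definition bs_union : set K := \bigcup_(i in setT) source_ball i.

Definition abs_open (V : set K) : Prop :=
  forall x, V x -> exists2 e : R, 0 < e & ball_ abs x e `<=` V.

Definition analytic_near (phi : {fraction {poly K}}) (U : set K) : Prop :=
  exists V : set K, [/\ abs_open V, U `<=` V &
    forall z, V z -> ~ rf_pole phi (Some z)].

Definition interprets_with_inclusion (phi : {fraction {poly K}}) : Prop :=
  analytic_near phi bs_union /\
  forall i, rf_eval phi @` source_ball i `<=` target_ball (bs_map S i).

End BallSystems.

(* Main.v *)
Require Import Defs.
From mathcomp Require Import all_boot all_order all_algebra.
From mathcomp Require Import all_classical all_reals.
From mathcomp Require Import topology normedtype.
From mathcomp Require Import sequences generic_quotient ring lra.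

Set Implicit Arguments.
Unset Strict Implicit.
Unset Printing Implicit Defensive.

Import Order.TTheory GRing.Theory Num.Theory.
Import numFieldNormedType.Exports.

Local Open Scope classical_set_scope.
Local Open Scope ring_scope.

(** The rational functions are finite sums of bumps.  For a centre [a], an
    exponent [m] and a constant [c],
<<
      b * c / ((a - z)^m + c)
>>
    is close to [b] where [|a - z|^m] is much smaller than [|c|], and close to
    [0] where it is much larger; in both regions the two terms of the
    denominator have different absolute values, so by the strong triangle
    inequality the denominator has the larger of the two as absolute value, and
    there is no pole.  If [r < d] then the ratio of [r^m] to [d^m] tends to [0],
    hence for [m] large some power of an element [x] with [0 < |x| < 1] has
    absolute value far from both: this gives [c] (separating_power) and then the
    bump (exists_bump).

    In a ball system each centre [a_i] is at a distance larger than the radius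
    [r_i] from the other centres, and its distance to a point of another ball
    [B_j] is exactly its distance to [a_j].  So there is a bump [h_i] within any
    prescribed [t > 0] of the centre of [B'_(tau i)] on [B_i] and of [0] on all
    the other balls.  When [t] is at most every target radius, the errors in
    [\sum_i h_i] do not accumulate, again by the strong triangle inequality, and
    this sum interprets [tau] with inclusion (exists_interpretation).  It has no
    pole on the union of the balls, which is open.

    Only a nontrivial non-archimedean absolute value is involved; in [C_p] the
    element [x] is [p], whose absolute value is [p^-1]. *)

(** * Evaluation of rational functions *)

Section Evaluation.
Variable K : fieldType.
Implicit Types (phi : {fraction {poly K}}) (P Q : {poly K}) (z : K).

Lemma frac_reprE phi :
  phi = tofrac (frac (repr phi)).1 / tofrac (frac (repr phi)).2.
Proof.
have d0 := denom_ratioP (repr phi).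
apply: (canRL (mulfK _)); first by rewrite tofrac_eq0.
rewrite -{1}[phi]reprK; unlock tofrac; rewrite -[LHS]FracField.pi_mul.
apply/eqmodP; rewrite /= FracField.equivfE /FracField.mulf.
by rewrite !numden_Ratio ?mulr1 ?oner_eq0 // mulrC.
Qed.

Lemma rf_numden_coprime phi : coprimep (rf_num phi) (rf_den phi).
Proof. by apply: coprimep_div_gcd; rewrite denom_ratioP orbT. Qed.

Lemma rf_den_neq0 phi : rf_den phi != 0.
Proof.
have d0 := denom_ratioP (repr phi).
by rewrite /rf_den dvdp_div_eq0 ?d0 // dvdp_gcdr.
Qed.

Lemma rf_numdenE phi : phi = tofrac (rf_num phi) / tofrac (rf_den phi).
Proof.
have d0 := denom_ratioP (repr phi).
have g0 : rf_gcd phi != 0 by rewrite gcdp_eq0 negb_and d0 orbT.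
rewrite [LHS]frac_reprE.
have nE := divpK (dvdp_gcdl (frac (repr phi)).1 (frac (repr phi)).2).
have dE := divpK (dvdp_gcdr (frac (repr phi)).1 (frac (repr phi)).2).
rewrite -[in X in X / _]nE -[in X in _ / X]dE.
by rewrite !tofracM -mulf_div divff ?mulr1 ?tofrac_eq0.
Qed.

(** Any representation of a rational function whose denominator does not vanish
    at [z] computes its value there: by coprimality, a common zero in the
    cross-multiplied identity cannot come from the reduced denominator. *)
Lemma rf_eval_frac P Q z : Q.[z] != 0 ->
  let phi := tofrac P / tofrac Q in
  ~ rf_pole phi (Some z) /\ rf_eval phi z = P.[z] / Q.[z].
Proof.
move=> Qz phi; rewrite /rf_pole /rf_eval.
have Q0 : Q != 0 by apply: contraNneq Qz => ->; rewrite horner0.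
have : tofrac (rf_num phi) / tofrac (rf_den phi) = tofrac P / tofrac Q.
  by rewrite -rf_numdenE.
move/eqP; rewrite eqr_div ?tofrac_eq0 ?rf_den_neq0 // -!tofracM tofrac_eq.
move=> /eqP/(congr1 (horner^~ z)); rewrite !hornerM => cross.
have denz : (rf_den phi).[z] != 0.
  apply/negP => /eqP den0; move/eqP: cross.
  rewrite den0 mulr0 mulf_eq0 (negPf Qz) orbF; apply/negP.
  have := rf_numden_coprime phi; rewrite coprimep_sym => /coprimep_root; apply.
  exact/rootP.
split; first by move/rootP; apply/eqP.
by apply/eqP; rewrite eqr_div // cross.
Qed.

Lemma rf_eval_add phi psi z :
  ~ rf_pole phi (Some z) -> ~ rf_pole psi (Some z) ->
  ~ rf_pole (phi + psi) (Some z) /\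
  rf_eval (phi + psi) z = rf_eval phi z + rf_eval psi z.
Proof.
move=> /negP phiz /negP psiz.
rewrite {1 2}[phi]rf_numdenE {1 2}[psi]rf_numdenE.
rewrite addf_div ?tofrac_eq0 ?rf_den_neq0 // -!tofracM -tofracD.
have denz : (rf_den phi * rf_den psi).[z] != 0 by rewrite hornerM mulf_neq0.
pose P := rf_num phi * rf_den psi + rf_num psi * rf_den phi.
have [? ->] := rf_eval_frac P denz.
by split=> //; rewrite /rf_eval /P addf_div // hornerD !hornerM.
Qed.

Lemma rf_eval_sum (I : finType) (phi : I -> {fraction {poly K}}) z :
  (forall i, ~ rf_pole (phi i) (Some z)) ->
  ~ rf_pole (\sum_i phi i) (Some z) /\
  rf_eval (\sum_i phi i) z = \sum_i rf_eval (phi i) z.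
Proof.
move=> regz.
pose rel (f : {fraction {poly K}}) v := ~ rf_pole f (Some z) /\ rf_eval f z = v.
apply: (big_ind2 rel).
- have : (1 : {poly K}).[z] != 0 by rewrite hornerC oner_eq0.
  by move/(rf_eval_frac 0); rewrite /rel tofrac0 mul0r hornerC mul0r.
- move=> f u g v [fz <-] [gz <-]; exact: rf_eval_add.
- by move=> i _; split.
Qed.

End Evaluation.

(** * Real estimates *)

(** The default value [c + 1] covers an empty range, in particular the other
    balls of a system reduced to a single ball. *)
Lemma exists_gap (R : realFieldType) (I : finType) (P : pred I) (f : I -> R)
    (c : R) : (forall i, P i -> c < f i) ->
  exists2 d, c < d & forall i, P i -> d <= f i.
Proof.
move=> cf; exists (\big[Order.min/c + 1]_(i | P i) f i).
  by apply: lt_bigmin => //; rewrite ltrDl.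
by move=> i Pi; exact: bigmin_le_cond.
Qed.

Lemma expr_small (R : realType) (q e : R) :
  0 <= q -> q < 1 -> 0 < e -> exists n : nat, q ^+ n <= e.
Proof.
move=> q0 q1 e0.
have /cvgrPdist_le/(_ e e0) : (fun n => q ^+ n) @ \oo --> (0 : R).
  by apply: cvg_expr; rewrite ger0_norm.
move=> [n _ /(_ n (leqnn n))] /=; rewrite sub0r normrN => h.
by exists n; exact: le_trans (ler_norm _) h.
Qed.

(** * Non-archimedean absolute values *)

Section NonArchimedean.
Variables (R : realType) (K : fieldType) (abs : K -> R).
Hypothesis nabs : nonarch_abs abs.

Lemma nabs0 : abs 0 = 0. Proof. exact/(nabs_eq0 nabs). Qed.

Lemma nabs_gt0 x : x != 0 -> 0 < abs x.
Proof.
move=> x0; rewrite lt_def (nabs_ge0 nabs) andbT.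
by apply: contraNneq x0 => /(nabs_eq0 nabs)->.
Qed.

Lemma nabs1 : abs 1 = 1.
Proof.
have /eqP := nabsM nabs 1 1; rewrite mulr1 -{1}[abs 1]mulr1.
by rewrite (inj_eq (mulfI (lt0r_neq0 (nabs_gt0 (oner_neq0 K))))) => /eqP.
Qed.

Lemma nabsX x n : abs (x ^+ n) = abs x ^+ n.
Proof. by elim: n => [|n IH]; rewrite ?nabs1 // !exprS (nabsM nabs) IH. Qed.

Lemma nabsV x : abs x^-1 = (abs x)^-1.
Proof.
have [->|x0] := eqVneq x 0; first by rewrite invr0 nabs0 invr0.
apply: (mulfI (lt0r_neq0 (nabs_gt0 x0))).
by rewrite -(nabsM nabs) !divff ?nabs1 // lt0r_neq0 // nabs_gt0.
Qed.

Lemma nabsN x : abs (- x) = abs x.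
Proof.
have absN1 : abs (-1) = 1.
  apply: (@pexpIrn _ 2) => //; rewrite ?nnegrE ?(nabs_ge0 nabs) ?ler01 //.
  by rewrite -nabsX sqrrN !expr1n nabs1.
by rewrite -mulN1r (nabsM nabs) absN1 mul1r.
Qed.

Lemma nabs_distC x y : abs (x - y) = abs (y - x).
Proof. by rewrite -opprB nabsN. Qed.

Lemma nabs_triangle x y z c :
  abs (x - y) <= c -> abs (y - z) <= c -> abs (x - z) <= c.
Proof.
move=> xy yz; rewrite -[x - z](subrKA y); apply: le_trans (nabsD nabs _ _) _.
by rewrite ge_max xy.
Qed.

Lemma nabs_sum (I : finType) (f : I -> K) c :
  0 <= c -> (forall i, abs (f i) <= c) -> abs (\sum_i f i) <= c.
Proof.
move=> c0 fc; elim/big_ind: _ => [|x y xc yc|//]; first by rewrite nabs0.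
by apply: le_trans (nabsD nabs _ _) _; rewrite ge_max xc.
Qed.

Lemma nabsD_dominant x y : abs x < abs y -> abs (x + y) = abs y.
Proof.
move=> xy; apply/eqP; rewrite eq_le; apply/andP; split.
  by apply: le_trans (nabsD nabs _ _) _; rewrite ge_max lexx ltW.
have := nabsD nabs (- x) (x + y).
by rewrite addKr nabsN le_max [abs y <= abs x]leNgt xy.
Qed.

(** Multiplying by [x] shrinks absolute values by the factor [|x|], so the powers
    of [x] meet every annulus whose radii have ratio [|x|].  The power with
    integer exponent is written [x^(n+1) / x^m], where [x^m] first brings [y]
    below [1]. *)
Lemma abs_in_annulus x y : 0 < abs x < 1 -> 0 < y ->
  exists c, abs c <= y /\ abs x * y <= abs c.
Proof.
move=> /andP[x0 x1] y0.
have y2 : 0 < (y + 1)^-1 by rewrite invr_gt0 addr_gt0.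
have [m] := expr_small (ltW x0) x1 y2; move: (exprn_gt0 m x0) => xm0 xm.
have xmy : abs x ^+ m * y < 1.
  have : abs x ^+ m * (y + 1) <= 1 by rewrite -ler_pdivlMr ?mul1r // addr_gt0.
  rewrite mulrDr mulr1; lra.
have exn : exists n, abs x ^+ n <= abs x ^+ m * y.
  by apply: expr_small => //; [exact: ltW | exact: mulr_gt0].
case: (ex_minnP exn) => -[|n] nle nmin.
  by move: nle; rewrite expr0 leNgt xmy.
exists (x ^+ n.+1 / x ^+ m); rewrite (nabsM nabs) nabsV !nabsX.
rewrite ler_pdivrMr // ler_pdivlMr // [y * _]mulrC; split=> //.
rewrite -mulrA [y * _]mulrC exprS ler_pM2l // leNgt.
by apply/negP => /ltW/nmin; rewrite ltnn.
Qed.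

(** Powers [m] stand in for roots of [c]: a value of [abs] strictly between [r]
    and [d] need not exist in a discretely valued field, but one between [r^m]
    and [d^m] does as soon as these are far enough apart. *)
Lemma separating_power x r d e : 0 < abs x < 1 -> 0 < r -> r < d -> 0 < e ->
  exists m c, r ^+ m <= e * abs c /\ abs c <= e * d ^+ m.
Proof.
move=> x01 r0 rd e0; have d0 := lt_trans r0 rd.
have x0 : 0 < abs x by case/andP: x01.
(* One factor [e] is spent on each side of [c], and the factor [abs x] is the
   width of the annulus in which [c] is found. *)
have [m] : exists m, (r / d) ^+ m <= abs x * e ^+ 2.
  apply: expr_small; rewrite ?divr_ge0 ?(ltW r0) ?(ltW d0) //.
    by rewrite ltr_pdivrMr // mul1r.
  by rewrite mulr_gt0 ?exprn_gt0.
have dm := exprn_gt0 m d0.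
rewrite expr_div_n ler_pdivrMr // => rm.
have [c [cle cge]] := abs_in_annulus x01 (mulr_gt0 e0 dm).
exists m, c; split=> //; apply: le_trans rm _.
have -> : abs x * e ^+ 2 * d ^+ m = e * (abs x * (e * d ^+ m)) by ring.
by rewrite ler_pM2l.
Qed.

Lemma exists_bump x a b r d t :
  0 < abs x < 1 -> 0 < r -> r < d -> 0 < t ->
  exists h : {fraction {poly K}},
    (forall z, abs (a - z) <= r ->
       ~ rf_pole h (Some z) /\ abs (rf_eval h z - b) <= t) /\
    (forall z, d <= abs (a - z) ->
       ~ rf_pole h (Some z) /\ abs (rf_eval h z) <= t).
Proof.
move=> x01 r0 rd t0; have d0 := lt_trans r0 rd.
have b0 := nabs_ge0 nabs b.
(* Chosen so that both [e < 1] and [abs b * e <= t], also when [b = 0]. *)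
pose e := t / (abs b + t + t).
have e0 : 0 < e by rewrite divr_gt0 //; lra.
have e1 : e < 1 by rewrite ltr_pdivrMr; lra.
have be : abs b * e <= t.
  rewrite mulrA ler_pdivrMr; last lra.
  by rewrite mulrC ler_pM2l //; lra.
have [m [c [rc cd]]] := separating_power x01 r0 rd e0.
have c0 : 0 < abs c by rewrite -(pmulr_rgt0 _ e0) (lt_le_trans _ rc) ?exprn_gt0.
pose Q := (a%:P - 'X) ^+ m + c%:P.
have Qz z : Q.[z] = (a - z) ^+ m + c.
  by rewrite hornerD horner_exp hornerD hornerN hornerX !hornerC.
have neq0 u : 0 < abs u -> u != 0.
  by apply: contraTneq => ->; rewrite nabs0 ltxx.
exists (tofrac (b * c)%:P / tofrac Q); split=> z az.
  have wc : abs ((a - z) ^+ m) <= e * abs c.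
    by rewrite nabsX; apply: le_trans rc; apply: lerXn2r;
      rewrite // nnegrE ?(nabs_ge0 nabs) // ltW.
  have absQ : abs ((a - z) ^+ m + c) = abs c.
    by apply: nabsD_dominant; apply: le_lt_trans wc _; rewrite gtr_pMl.
  have Q0 : Q.[z] != 0 by apply: neq0; rewrite Qz absQ.
  have [? ->] := rf_eval_frac (b * c)%:P Q0; split=> //.
  have -> : (b * c)%:P.[z] / Q.[z] - b = - (b * (a - z) ^+ m / Q.[z]).
    apply: (mulIf Q0); rewrite mulrBl mulNr !divfK //.
    by rewrite hornerC Qz mulrDr opprD addrCA subrr addr0.
  rewrite nabsN !(nabsM nabs) nabsV Qz absQ ler_pdivrMr //.
  apply: le_trans (_ : abs b * (e * abs c) <= _); first exact: ler_wpM2l.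
  by rewrite mulrA ler_pM2r.
have az0 := lt_le_trans d0 az.
have cw : abs c <= e * abs ((a - z) ^+ m).
  rewrite nabsX; apply: le_trans cd _; rewrite ler_pM2l //.
  by apply: lerXn2r; rewrite // nnegrE ?(nabs_ge0 nabs) // ltW.
have w0 : 0 < abs ((a - z) ^+ m) by rewrite nabsX exprn_gt0.
have absQ : abs ((a - z) ^+ m + c) = abs ((a - z) ^+ m).
  by rewrite addrC; apply: nabsD_dominant;
    apply: le_lt_trans cw _; rewrite gtr_pMl.
have Q0 : Q.[z] != 0 by apply: neq0; rewrite Qz absQ.
have [? ->] := rf_eval_frac (b * c)%:P Q0; split=> //.
rewrite hornerC Qz !(nabsM nabs) nabsV absQ ler_pdivrMr //.
apply: le_trans (_ : abs b * (e * abs ((a - z) ^+ m)) <= _).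
  exact: ler_wpM2l.
by rewrite mulrA ler_pM2r.
Qed.

(** * Interpretation of ball systems *)

Section BallSystem.
Variables (N : nat) (S : ball_system abs N).

Lemma centers_far i j : i != j ->
  Defs.radius S i < abs (Defs.center S i - Defs.center S j).
Proof.
move=> ij; rewrite ltNge; apply/negP => near; move/eqP: ij; apply.
apply: (@balls_disjoint _ _ _ _ S i j) => //.
exists (Defs.center S j); split=> //.
by rewrite /closed_ball_ /= subrr nabs0 ltW ?Defs.radius_gt0.
Qed.

(** The strong triangle inequality makes the distance to an outside point
    constant on a ball. *)
Lemma center_dist i j z : i != j -> source_ball S j z ->
  abs (Defs.center S i - z) = abs (Defs.center S i - Defs.center S j).
Proof.
move=> ij jz; rewrite -(subrKA (Defs.center S j)) addrC.
apply: nabsD_dominant; apply: le_lt_trans jz _.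
by rewrite nabs_distC; apply: centers_far; rewrite eq_sym.
Qed.

Lemma bs_union_open : abs_open abs (bs_union S).
Proof.
move=> z [i _ iz]; exists (Defs.radius S i); first exact: Defs.radius_gt0.
by move=> w zw; exists i => //; apply: nabs_triangle iz _; exact: ltW.
Qed.

Lemma exists_interpretation x : 0 < abs x < 1 ->
  exists phi, (forall z, bs_union S z -> ~ rf_pole phi (Some z)) /\
    forall i, rf_eval phi @` source_ball S i `<=` target_ball S (bs_map S i).
Proof.
move=> x01.
have [t t0 tle] : exists2 t, 0 < t & forall i, t <= target_radius S i.
  have [|t t0 tle] := @exists_gap R 'I_N predT (target_radius S) 0.
    by move=> i _; exact: target_radius_gt0.
  by exists t => // i; exact: tle.
pose b i := target_center S (bs_map S i).
have /choice[h hP] i : exists h : {fraction {poly K}},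
    (forall z, source_ball S i z ->
       ~ rf_pole h (Some z) /\ abs (rf_eval h z - b i) <= t) /\
    (forall j z, i != j -> source_ball S j z ->
       ~ rf_pole h (Some z) /\ abs (rf_eval h z) <= t).
  have [d rd dle] := exists_gap (@centers_far i).
  have [h [hin hout]] :=
    exists_bump (Defs.center S i) (b i) x01 (Defs.radius_gt0 S i) rd t0.
  exists h; split=> [z|j z ij jz]; first exact: hin.
  by apply: hout; rewrite (center_dist ij jz); exact: dle.
have reg j z : source_ball S j z -> forall i, ~ rf_pole (h i) (Some z).
  move=> jz i; have [hin hout] := hP i.
  have [ij|ij] := eqVneq i j; last by have [] := hout j z ij jz.
  by rewrite -ij in jz; have [] := hin z jz.
exists (\sum_i h i); split=> [z [j _ jz]|j w [z jz <-]].
  by have [] := rf_eval_sum (reg _ _ jz).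
have [_ ->] := rf_eval_sum (reg _ _ jz).
rewrite /target_ball /closed_ball_ /= nabs_distC.
apply: le_trans (tle (bs_map S j)).
(* Spread [b j] over the sum, so that each term is small on its own. *)
have -> : \sum_i rf_eval (h i) z - b j =
    \sum_i (rf_eval (h i) z - (if i == j then b j else 0)).
  by rewrite sumrB -big_mkcond big_pred1_eq.
apply: nabs_sum => [|i]; first exact: ltW.
have [hin hout] := hP i.
have [ij|ij] := eqVneq i j; last by rewrite subr0; have [] := hout j z ij jz.
by rewrite -ij in jz *; have [] := hin z jz.
Qed.

End BallSystem.
End NonArchimedean.

(** * The absolute value of [C_p] *)

Lemma Cp_nonarch (R : realType) (p : nat) (K : fieldType) (abs : K -> R) :
  is_Cp p abs -> nonarch_abs abs.
Proof. by move=> [Qp [? [? [? [? [? [? [_ _ _ _ []]]]]]]]]. Qed.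

Lemma Cp_abs_p (R : realType) (p : nat) (K : fieldType) (abs : K -> R) :
  prime p -> is_Cp p abs -> abs p%:R = p%:R^-1.
Proof.
move=> pp [Qp [absQp [i [Qpbar [absbar [j [k [compQ _ _ absj compK]]]]]]]].
have -> : p%:R = k (j (i p%:R)) by rewrite !rmorph_nat.
rewrite (completion_isometry compK) absj (completion_isometry compQ).
rewrite /padic_abs pnatr_eq0 gtn_eqF ?prime_gt0 //=.
have -> : p%:R = p%:~R :> rat by [].
rewrite numq_int denq_int logn1 sub0r absz_nat logn_prime // eqxx.
by rewrite exprN1.
Qed.

Theorem corollary5p10 (R : realType) (p : nat) (hp : prime p)
    (K : fieldType) (abs : K -> R) (hK : is_Cp p abs)
    (N : nat) (S : ball_system abs N) :
  exists phi : {fraction {poly K}},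
    [/\ interprets_with_inclusion S phi,
        forall z : K, bs_union S z -> ~ rf_pole phi (Some z)
      & [set x | rf_pole phi x] `<=` ~` (Some @` bs_union S)].
Proof.
have nabs := Cp_nonarch hK.
have p01 : 0 < abs p%:R < 1.
  rewrite (Cp_abs_p hp hK) invr_gt0 ltr0n prime_gt0 //=.
  by rewrite invf_lt1 ?ltr1n ?ltr0n ?prime_gt1 ?prime_gt0.
have [phi [reg incl]] := exists_interpretation nabs S p01.
exists phi; split=> //; first split=> //.
  by exists (bs_union S); split=> //; exact: bs_union_open.
by move=> x pole [z Uz zE]; rewrite -zE in pole; exact: reg pole.
Qed.
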